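(* Let $n,m\ge 1$ be integers, let $A_0,A_1,\ldots,A_m\in\mathbb{R}^{n\times n}$ and let $\tau_1,\ldots,\tau_m>0$. Let $X(t)\in\mathbb{R}^{n\times n}$ be the fundamental matrix of the linear delay differential system $$\dot{x}(t)=A_0x(t)+\sum_{j=1}^{m}A_jx(t-\tau_j).$$ Then this system is asymptotically stable if and only if $$\int_0^\infty\|X(\sigma)\|\,d\sigma\quad\text{exists and is finite}.$$
   Context: The fundamental matrix $X:\mathbb{R}\to\mathbb{R}^{n\times n}$ of the system $\dot{x}(t)=A_0x(t)+\sum_{j=1}^{m}A_jx(t-\tau_j)$ is the unique function that is continuous on $[0,\infty)$ and satisfies $$\dot{X}(t)=A_0X(t)+\sum_{j=1}^{m}A_jX(t-\tau_j)\quad\text{for } t\ge 0,\qquad X(t)=0\ \text{for } t<0,\qquad X(0)=I,$$ where $I$ is the identity matrix and $\dot X(t)$ is understood as the right-hand derivative (at points such as $t=0$ and $t=\tau_j$ the two-sided derivative need not exist). Asymptotic stability of the system is characterized as follows: the system is asymptotically stable if and only if there exist constants $\alpha>0$ and $\gamma>0$ such that $\|X(t)\|\le\gamma\exp(-\alpha t)$ for all $t\in[0,\infty)$. Here $\|\cdot\|$ denotes a matrix norm on $\mathbb{R}^{n\times n}$, and $\int_0^\infty\|X(\sigma)\|\,d\sigma=\lim_{t\to\infty}\int_0^t\|X(\sigma)\|\,d\sigma$. *)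

(* Defs.v *)
From HB Require Import structures.
From mathcomp Require Import all_boot all_order all_algebra.
From mathcomp Require Import all_classical all_reals all_analysis.
Set Implicit Arguments.
Unset Strict Implicit.
Unset Printing Implicit Defensive.
Import Order.TTheory GRing.Theory Num.Theory.
Import numFieldNormedType.Exports.
Local Open Scope classical_set_scope.
Local Open Scope ring_scope.

Definition right_derivative {R : realType} {V : normedModType R}
    (f : R -> V) (t : R) (l : V) : Prop :=
  h^-1 *: (f (t + h) - f t) @[h --> 0^'+] --> l.

(* With p = 1 this is the right-hand side of the vector system, with p = n the
   one of the matrix equation of the fundamental matrix. *)
Definition delay_rhs {R : realType} {n m p : nat} (A0 : 'M[R]_n)
    (A : 'I_m -> 'M[R]_n) (tau : 'I_m -> R) (Y : R -> 'M[R]_(n, p)) (t : R) :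
    'M[R]_(n, p) :=
  A0 *m Y t + \sum_(j < m) A j *m Y (t - tau j).

Definition is_fundamental_matrix {R : realType} {n m : nat} (A0 : 'M[R]_n)
    (A : 'I_m -> 'M[R]_n) (tau : 'I_m -> R) (X : R -> 'M[R]_n) : Prop :=
  [/\ {within `[0, +oo[, continuous X},
      forall t : R, 0 <= t -> right_derivative X t (delay_rhs A0 A tau X t),
      forall t : R, t < 0 -> X t = 0
    & X 0 = 1%:M].

(* The delays are positive in all uses, so the default value 0 is harmless. *)
Definition max_delay {R : realType} {m : nat} (tau : 'I_m -> R) : R :=
  \big[Num.max/0]_(j < m) tau j.

(* Initial value problem with initial function phi on [- max_delay tau, 0];
   values of x and phi to the left of this interval are irrelevant. *)
Definition is_solution {R : realType} {n m : nat} (A0 : 'M[R]_n)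
    (A : 'I_m -> 'M[R]_n) (tau : 'I_m -> R) (phi x : R -> 'cV[R]_n) : Prop :=
  [/\ forall t : R, - max_delay tau <= t <= 0 -> x t = phi t,
      {within `[0, +oo[, continuous x}
    & forall t : R, 0 <= t -> right_derivative x t (delay_rhs A0 A tau x t)].

(* Lyapunov stability and attractivity of the zero solution, for continuous
   initial functions.  The system is linear, so attractivity is global. *)
Definition asymptotically_stable {R : realType} {n m : nat} (A0 : 'M[R]_n)
    (A : 'I_m -> 'M[R]_n) (tau : 'I_m -> R) : Prop :=
  (forall eps : R, 0 < eps -> exists2 delta : R, 0 < delta &
     forall phi x : R -> 'cV[R]_n,
       {within `[- max_delay tau, 0], continuous phi} ->
       (forall t : R, - max_delay tau <= t <= 0 -> `|phi t| < delta) ->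
       is_solution A0 A tau phi x ->
       forall t : R, 0 <= t -> `|x t| < eps) /\
  (forall phi x : R -> 'cV[R]_n,
     {within `[- max_delay tau, 0], continuous phi} ->
     is_solution A0 A tau phi x ->
     x t @[t --> +oo] --> (0 : 'cV[R]_n)).

(* Submultiplicativity is not required. *)
Definition is_matrix_norm {R : realType} {n : nat} (N : 'M[R]_n -> R) : Prop :=
  [/\ forall B, N B = 0 -> B = 0,
      forall (a : R) B, N (a *: B) = `|a| * N B
    & forall B C, N (B + C) <= N B + N C].

(* The integral over [0, +oo[ as a limit of integrals over [0, t]; the limit
   is taken in R, hence finite. *)
Definition improper_integral_exists {R : realType} (f : R -> R) : Prop :=
  cvg ((\int[@lebesgue_measure R]_(s in `[0, t]) f s) @[t --> +oo]).

(* Main.v *)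
Require Import Defs.
From HB Require Import structures.
From mathcomp Require Import all_boot all_order all_algebra.
From mathcomp Require Import all_classical all_reals all_analysis.
From mathcomp Require Import lra ring.
Import Order.TTheory GRing.Theory Num.Theory.
Import numFieldNormedType.Exports.
Local Open Scope classical_set_scope.
Local Open Scope ring_scope.

(** Write L Y (t) = A0 Y(t) + sum_j A_j Y(t - tau_j) for the right-hand side of
    the system, h for the largest delay, and |.| for the entrywise maximum
    norm, to which every matrix norm N is equivalent.

    Both properties are equivalent to a third one: X(t) tends to 0 as t tends
    to infinity.  What makes this weak-looking property strong is the estimate
      |x(t)| <= C * sup_[t - h, t] |X| * sup_[-h, 0] |phi|
    for every solution x with initial function phi ([solution_norm_le]), where
    C depends on the system only.  It is the estimate that one reads off the
    variation-of-constants formula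
      x(t) = X(t) phi(0) + sum_j int_0^tau_j X(t - u) A_j phi(u - tau_j) du.
    The formula itself is avoided, and with it all differentiation under the
    integral sign.  Let P(t) be the integral of X over [0, t].  Integrating the
    equation of X gives X = H + L P, where H is I on [0, +oo[ and 0 before, so
    that W(t) = (P(t - b) - P(t - c)) v solves W' = L W + 1_[b, c[ v and is at
    most (c - b) |v| sup |X| up to a constant.  Summing such functions solves
    W' = L W + r for a step function r as close as desired to the forcing term
    that phi exerts ([duhamel_approx_exists]), and a Gronwall inequality
    ([delay_gronwall]) makes the remaining error arbitrarily small.

    Stability implies that X tends to 0, because the columns of X(. + h) are
    solutions with a continuous initial function.  If X tends to 0, then the
    estimate, applied to columns of X(. + s) with s >= h, shows that sup |X| is
    halved over a fixed length of time, so X decays geometrically and N(X) is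
    integrable ([vanishes_integral]).  Conversely, if N(X) is integrable then P
    has a limit Q at infinity; by X = H + L P so has X, namely I + L Q, and this
    limit is 0 because otherwise P would grow linearly ([integral_vanishes]).
    Then the estimate gives stability and attractivity at once ([vanishes_stable]).

    Derivatives are one-sided throughout; the substitute for the fundamental
    theorem of calculus is [mean_value_right]. *)

Set Implicit Arguments.
Unset Strict Implicit.

(** * Comparison of functions by their right derivatives *)

(** The supremum of the t such that P holds on [a, t] belongs to that set by the
    left-limit hypothesis, and would not be an upper bound of it if it were
    less than b. *)
Lemma real_induction (R : realType) (a b : R) (P : R -> Prop) :
    P a ->
    (forall t, a <= t < b -> (forall s, a <= s <= t -> P s) ->
       \forall s \near t^'+, P s) ->
    (forall t, a < t <= b -> (forall s, a <= s < t -> P s) -> P t) ->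
  forall t, a <= t <= b -> P t.
Proof.
move=> Pa Pr Pl.
pose S := [set t | a <= t <= b /\ forall s, a <= s <= t -> P s].
move=> t0 /andP[at0 t0b]; have ab := le_trans at0 t0b.
have Sa : S a.
  by split; [rewrite lexx|move=> s; rewrite -eq_le => /eqP <-].
have Sub : has_ubound S by exists b => s -[/andP[]].
have Ssup : has_sup S by split; [exists a|].
have aS : a <= sup S by exact: ub_le_sup.
have Sb : sup S <= b by apply: ge_sup; [exists a|move=> s [/andP[]]].
have Plt s : a <= s < sup S -> P s.
  move=> /andP[as_ sS].
  have [r [_ Sr] sr] := sup_gt (ex_intro _ a Sa) sS.
  by apply: Sr; rewrite as_ ltW.
have PS s : a <= s <= sup S -> P s.
  move=> /andP[as_]; rewrite le_eqVlt => /predU1P[->|sS]; last first.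
    by apply: Plt; rewrite as_.
  move: (aS); rewrite le_eqVlt => /predU1P[<-//|a_lt].
  by apply: Pl => //; rewrite a_lt.
have [Seqb|Sltb] : sup S = b \/ sup S < b.
  by move: Sb; rewrite le_eqVlt => /predU1P[]; [left|right].
  by apply: PS; rewrite at0 Seqb.
have [e/= e0 He] := Pr (sup S) (introT andP (conj aS Sltb)) PS.
pose r := Num.min (sup S + e / 2) b.
have Sr : sup S < r by rewrite lt_min Sltb ltrDl divr_gt0.
suff : S r by move/(ub_le_sup Sub); rewrite leNgt Sr.
split; first by rewrite (le_trans aS (ltW Sr)) ge_min lexx orbT.
move=> s /andP[as_ sr]; have [sS|Ss] := leP s (sup S).
  by apply: PS; rewrite as_.
apply: He => //=; rewrite ltr0_norm ?subr_lt0// opprB ltrBlDl.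
apply: le_lt_trans sr _; rewrite gt_min ltrD2l; apply/orP; left.
by rewrite ltr_pdivrMr// ltr_pMr// ltr1n.
Qed.

(** The last hypothesis asks that u should grow at least as fast as f moves, but
    only at times up to which the bound already holds; this is what makes the
    lemma usable for Gronwall estimates. *)
Lemma comparison (R : realType) (V : normedModType R) (f : R -> V) (u : R -> R)
    (a b : R) :
    (forall t, a < t <= b -> f s @[s --> t^'-] --> f t) ->
    (forall t, a < t <= b -> u s @[s --> t^'-] --> u t) ->
    `|f a| <= u a ->
    (forall t, a <= t < b -> (forall s, a <= s <= t -> `|f s| <= u s) ->
       \forall h \near 0^'+, `|f (t + h) - f t| <= u (t + h) - u t) ->
  forall t, a <= t <= b -> `|f t| <= u t.
Proof.
move=> fl ul fa step; apply: real_induction => // t tab IH.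
  apply/nbhs_right0P; apply: filterS (step t tab IH) => h H.
  rewrite -[f _](subrK (f t)) (le_trans (ler_normD _ _))//.
  rewrite -[leRHS](subrK (u t)) lerD//.
  by apply: IH; rewrite lexx; case/andP: tab => ->.
have a_t : a < t by case/andP: tab.
have nfl : `|f s| @[s --> t^'-] --> `|f t| by apply: cvg_norm; exact: fl.
apply: (ler_cvg_to nfl (ul t tab)).
near=> s; apply: IH; apply/andP; split=> //.
by near: s; exact: nbhs_left_ge.
Unshelve. all: by end_near. Qed.

Lemma right_derivative_norm_le (R : realType) (V : normedModType R)
    (f : R -> V) (t : R) (l : V) (c : R) :
    right_derivative f t l -> `|l| < c ->
  \forall h \near 0^'+, `|f (t + h) - f t| <= c * h.
Proof.
move=> fl lc; near=> h.
have h0 : 0 < h by near: h; exact: nbhs_right_gt.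
have : `|h^-1 *: (f (t + h) - f t)| <= c.
  near: h; have /cvgr_norm_le := fl.
  by apply.
by rewrite normrZ gtr0_norm ?invr_gt0// ler_pdivrMl// mulrC.
Unshelve. all: by end_near. Qed.

Lemma right_derivative_ge (R : realType) (f : R -> R) (t l c : R) :
    right_derivative f t l -> c < l ->
  \forall h \near 0^'+, c * h <= f (t + h) - f t.
Proof.
move=> fl lc; near=> h.
have h0 : 0 < h by near: h; exact: nbhs_right_gt.
have : c <= h^-1 *: (f (t + h) - f t).
  by near: h; have /cvgr_ge := fl; apply.
by rewrite /GRing.scale/= ler_pdivlMl// mulrC.
Unshelve. all: by end_near. Qed.

(** Adding a small slope d to u turns the inequality between the derivatives
    into a strict one, which then holds for the difference quotients. *)
Lemma mean_value_right (R : realType) (V : normedModType R)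
    (f f' : R -> V) (u u' : R -> R) (a b : R) : a <= b ->
    (forall t, a < t <= b -> f s @[s --> t^'-] --> f t) ->
    (forall t, a < t <= b -> u s @[s --> t^'-] --> u t) ->
    (forall t, a <= t < b -> right_derivative f t (f' t)) ->
    (forall t, a <= t < b -> right_derivative u t (u' t)) ->
    (forall t, a <= t < b -> `|f' t| <= u' t) ->
  `|f b - f a| <= u b - u a.
Proof.
move=> ab fl ul fd ud fu; apply/ler_addgt0Pr => e e0.
(* the term + 1 avoids a division by zero when a = b *)
pose d := e / (b - a + 1).
have ba : 0 < b - a + 1 by rewrite ltr_wpDl// subr_ge0.
have d0 : 0 < d by rewrite divr_gt0.
suff H : `|f b - f a| <= u b - u a + d * (b - a).
  apply: (le_trans H); rewrite lerD2l /d mulrAC ler_pdivrMr// ler_pM2l//.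
  by rewrite lerDl.
apply: (@comparison R V (fun t => f t - f a)
  (fun t => u t - u a + d * (t - a)) a b) => [t tab|t tab||t tab _|].
- by apply: cvgB; [exact: fl|exact: cvg_cst].
- apply: cvgD; first by apply: cvgB; [exact: ul|exact: cvg_cst].
  apply: cvgM; first exact: cvg_cst.
  apply: cvgB; last exact: cvg_cst.
  by apply: cvg_at_left_filter; exact: cvg_id.
- by rewrite !subrr mulr0 normr0 addr0.
- near=> h.
  have H1 : `|f (t + h) - f t| <= (`|f' t| + d / 2) * h.
    near: h; apply: right_derivative_norm_le (fd _ tab) _.
    by rewrite ltrDl divr_gt0.
  have H2 : (u' t - d / 2) * h <= u (t + h) - u t.
    near: h; apply: right_derivative_ge (ud _ tab) _.
    by rewrite ltrBlDr ltrDl divr_gt0.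
  have h0 : 0 < h by near: h; exact: nbhs_right_gt.
  have -> : f (t + h) - f a - (f t - f a) = f (t + h) - f t.
    by rewrite opprB addrA subrK.
  have : `|f' t| * h <= u' t * h by rewrite ler_pM2r//; exact: fu.
  by move=> H3; apply: (le_trans H1); lra.
- by rewrite lexx ab.
Unshelve. all: by end_near. Qed.

(** * Calculus of right derivatives and left limits *)

Lemma right_derivativeD (R : realType) (V : normedModType R) (f g : R -> V)
    (t : R) (l k : V) :
  right_derivative f t l -> right_derivative g t k ->
  right_derivative (fun s => f s + g s) t (l + k).
Proof.
move=> fl gk; rewrite /right_derivative.
under eq_fun do rewrite opprD addrACA scalerDr.
exact: cvgD fl gk.
Qed.

Lemma right_derivativeB (R : realType) (V : normedModType R) (f g : R -> V)
    (t : R) (l k : V) :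
  right_derivative f t l -> right_derivative g t k ->
  right_derivative (fun s => f s - g s) t (l - k).
Proof.
move=> fl gk; rewrite /right_derivative.
under eq_fun do rewrite opprD addrACA -opprD scalerBr.
exact: cvgB fl gk.
Qed.

Lemma right_derivative_cst (R : realType) (V : normedModType R) (c : V) (t : R) :
  right_derivative (fun=> c) t 0.
Proof.
rewrite /right_derivative; under eq_fun do rewrite subrr scaler0.
exact: cvg_cst.
Qed.

Lemma right_derivative_linear (R : realType) (V : normedModType R) (v : V) (t : R) :
  right_derivative (fun s : R => s *: v) t v.
Proof.
rewrite /right_derivative.
apply: (@cvg_trans _ ((fun=> v) @ 0^'+)); last exact: cvg_cst.
apply: near_eq_cvg; near=> h.
have h0 : 0 < h by near: h; exact: nbhs_right_gt.
by rewrite -scalerBl addrC addKr scalerA mulVf ?scale1r// gt_eqF.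
Unshelve. all: by end_near. Qed.

Lemma right_derivative_sum (R : realType) (V : normedModType R) (m : nat)
    (f : 'I_m -> R -> V) (t : R) (l : 'I_m -> V) :
    (forall j, right_derivative (f j) t (l j)) ->
  right_derivative (fun s => \sum_(j < m) f j s) t (\sum_(j < m) l j).
Proof.
move=> fl; rewrite /right_derivative.
under eq_fun do rewrite -sumrB scaler_sumr.
by apply: cvg_big => [|j _]; [exact: add_continuous|exact: fl].
Qed.

Lemma right_derivative_eq (R : realType) (V : normedModType R) (f g : R -> V)
    (t : R) (l : V) :
    f t = g t -> (\forall s \near t^'+, f s = g s) ->
  right_derivative f t l -> right_derivative g t l.
Proof.
move=> fgt /nbhs_right0P fg; apply: cvg_trans; apply: near_eq_cvg.
by apply: filterS fg => h; rewrite fgt => ->.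
Qed.

Lemma right_derivative_shift (R : realType) (V : normedModType R) (f : R -> V)
    (c t : R) (l : V) :
  right_derivative f (t + c) l -> right_derivative (fun s => f (s + c)) t l.
Proof.
rewrite /right_derivative; apply: cvg_trans; apply: near_eq_cvg.
by apply: nearW => h; rewrite addrAC.
Qed.

Lemma cvg_left_shift (R : realType) (V : normedModType R) (f : R -> V)
    (c t : R) :
    f s @[s --> (t + c)^'-] --> f (t + c) ->
  f (s + c) @[s --> t^'-] --> f (t + c).
Proof.
move=> H; apply/cvgrPdist_le => e e0.
have /cvgrPdist_le/(_ e e0)/nbhs_left0P {}H := H.
by apply/nbhs_left0P; apply: filterS H => h; rewrite addrAC.
Qed.

(** * The entrywise maximum norm *)

Lemma mx_norm_entry (R : realType) (n p : nat) (B : 'M[R]_(n, p)) i j :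
  `|B i j| <= `|B|.
Proof.
by rewrite [leRHS]/Num.norm/= mx_normrE; apply/bigmax_geP; right; exists (i, j).
Qed.

Lemma mx_norm_le (R : realType) (n p : nat) (B : 'M[R]_(n, p)) (c : R) :
  0 <= c -> (forall i j, `|B i j| <= c) -> `|B| <= c.
Proof.
by move=> c0 Bc; rewrite [leLHS]/Num.norm/= mx_normrE; apply/bigmax_leP; split.
Qed.

Lemma mx_norm_mulmx (R : realType) (n p q : nat) (B : 'M[R]_(n, p))
    (C : 'M[R]_(p, q)) : `|B *m C| <= p%:R * `|B| * `|C|.
Proof.
apply: mx_norm_le => [|i j]; first by rewrite !mulr_ge0.
rewrite mxE (le_trans (ler_norm_sum _ _ _))//.
rewrite -mulrA mulr_natl -[X in _ *+ X](card_ord p) -sumr_const ler_sum// => k _.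
by rewrite normrM ler_pM// mx_norm_entry.
Qed.

(** * Matrix-valued limits and derivatives *)

Lemma cvg_mulmxl (R : realType) (T : Type) (F : set_system T) (FF : Filter F)
    (n p q : nat) (B : 'M[R]_(n, p)) (f : T -> 'M[R]_(p, q)) (l : 'M[R]_(p, q)) :
  f t @[t --> F] --> l -> B *m f t @[t --> F] --> B *m l.
Proof.
move=> fl; apply/cvgrPdist_le => e e0.
have c0 : 0 < p%:R * `|B| + 1 by rewrite ltr_wpDl// mulr_ge0.
have /cvgrPdist_le/(_ (e / (p%:R * `|B| + 1))) H := fl.
apply: filterS (H (divr_gt0 e0 c0)) => t.
rewrite ler_pdivlMr// -mulmxBr => Ht; apply: (le_trans (mx_norm_mulmx _ _)).
by apply: le_trans Ht; rewrite mulrC ler_wpM2l// lerDl.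
Qed.

Lemma cvg_mulmxr (R : realType) (T : Type) (F : set_system T) (FF : Filter F)
    (n p q : nat) (C : 'M[R]_(p, q)) (f : T -> 'M[R]_(n, p)) (l : 'M[R]_(n, p)) :
  f t @[t --> F] --> l -> f t *m C @[t --> F] --> l *m C.
Proof.
move=> fl; apply/cvgrPdist_le => e e0.
have c0 : 0 < p%:R * `|C| + 1 by rewrite ltr_wpDl// mulr_ge0.
have /cvgrPdist_le/(_ (e / (p%:R * `|C| + 1))) H := fl.
apply: filterS (H (divr_gt0 e0 c0)) => t.
rewrite ler_pdivlMr// -mulmxBl => Ht; apply: (le_trans (mx_norm_mulmx _ _)).
by apply: le_trans Ht; rewrite mulrAC mulrC ler_wpM2l// lerDl.
Qed.

Lemma right_derivative_mulmxl (R : realType) (n p q : nat) (B : 'M[R]_(n, p))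
    (f : R -> 'M[R]_(p, q)) (t : R) (l : 'M[R]_(p, q)) :
  right_derivative f t l -> right_derivative (fun s => B *m f s) t (B *m l).
Proof.
rewrite /right_derivative => fl.
under eq_fun do rewrite -mulmxBr scalemxAr.
exact: cvg_mulmxl.
Qed.

Lemma right_derivative_mulmxr (R : realType) (n p q : nat) (C : 'M[R]_(p, q))
    (f : R -> 'M[R]_(n, p)) (t : R) (l : 'M[R]_(n, p)) :
  right_derivative f t l -> right_derivative (fun s => f s *m C) t (l *m C).
Proof.
rewrite /right_derivative => fl.
under eq_fun do rewrite -mulmxBl scalemxAl.
exact: cvg_mulmxr.
Qed.

Lemma cvg_mx_entry (R : realType) (T : Type) (F : set_system T) (FF : Filter F)
    (n p : nat) (f : T -> 'M[R]_(n, p)) (l : 'M[R]_(n, p)) :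
  (f t @[t --> F] --> l) <-> (forall i j, f t i j @[t --> F] --> l i j).
Proof.
split=> [fl i j|fl]; apply/cvgrPdist_le => e e0.
  have /cvgrPdist_le/(_ e e0) H := fl.
  apply: filterS H => t; apply: le_trans.
  by have := mx_norm_entry (l - f t) i j; rewrite !mxE.
have H : \forall t \near F, forall ij : 'I_n * 'I_p,
    `|l ij.1 ij.2 - f t ij.1 ij.2| <= e.
  apply: filter_forall => ij.
  by have /cvgrPdist_le/(_ e e0) := fl ij.1 ij.2.
apply: filterS H => t H; apply: mx_norm_le => [|i j]; first exact: ltW.
by have := H (i, j); rewrite !mxE.
Qed.

(** * The integral as a primitive from the right *)

(** The two-sided fundamental theorem of calculus applies away from the left end
    of the domain.  To reach 0, f is extended to the left by the constant f 0
    and integrated from -1. *)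
Lemma integral_right_primitive (R : realType) (f : R -> R)
    (F := fun t : R => \int[@lebesgue_measure R]_(s in `[0, t]) f s) :
    {within `[0, +oo[, continuous f} ->
  [/\ forall t : R, t <= 0 -> F t = 0,
      forall t : R, F s @[s --> t^'-] --> F t
    & forall t : R, 0 <= t -> right_derivative F t (f t)].
Proof.
move=> fc.
have F0 (t : R) : t <= 0 -> F t = 0.
  rewrite /F le_eqVlt => /predU1P[->|t0]; first by rewrite set_itv1 Rintegral_set1.
  by rewrite set_itv_ge ?Rintegral_set0// bnd_simp -ltNge.
pose g (s : R) := f (Num.max s 0).
have gc : continuous g.
  move=> t.
  have /subspace_continuousP/(_ (Num.max t 0)) := fc.
  have m0 : 0 <= Num.max t 0 by rewrite le_max lexx orbT.
  rewrite /= in_itv/= m0 => /(_ isT) H.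
  apply: (@cvg_comp _ _ _ (fun s => Num.max s 0) f _ _ _ _ H).
  move=> A; rewrite /within/= nbhsE/= => -[B [oB Bt] BA].
  have mc : {for t, continuous (fun s : R => Num.max s 0)}.
    by apply: continuous_max; [exact: cvg_id|exact: cvg_cst].
  have Bm : \forall s \near t, B (Num.max s 0) by apply: mc; exact: open_nbhs_nbhs.
  suff : \forall s \near t, A (Num.max s 0) by [].
  apply: filterS Bm => s Bs; apply: BA => //=.
  by rewrite in_itv/= le_max lexx orbT.
pose G (t : R) := \int[@lebesgue_measure R]_(s in `[-1, t]) g s.
have gi a b : (@lebesgue_measure R).-integrable `[a, b] (EFin \o g).
  apply: continuous_compact_integrable; first exact: segment_compact.
  exact: continuous_subspaceT.
have FG (t : R) : 0 <= t -> F t = G t - G 0.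
  move=> t0; rewrite /G Rintegral_itvB//; last first.
    by rewrite bnd_simp lerN10.
  rewrite Rintegral_itv_obnd_cbnd; last first.
    by apply: integrableS (gi 0 t) => //; exact: subset_itv_oc_cc.
  apply: eq_Rintegral => s; rewrite inE/= in_itv/= => /andP[s0 _].
  by rewrite /g max_l.
have GD : forall t : R, 0 <= t -> derivable G t 1 /\ derive1 G t = g t.
  move=> t t0; apply: (@continuous_FTC1_closed R g (-1) t (t + 1)) => //.
  - by rewrite ltrDl.
  - by rewrite (lt_le_trans _ t0).
  - exact: gc.
have GR : forall t : R, 0 <= t -> right_derivative G t (g t).
  move=> t t0; have [Gd <-] := GD t t0.
  rewrite /right_derivative; apply: cvg_dnbhs_at_right.
  rewrite derive1E; move: Gd; rewrite /derivable /derive => Gd.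
  have -> : (fun h : R => h^-1 *: (G (t + h) - G t)) = 
    (fun h : R => h^-1 *: (((G \o shift t) (h *: 1) : R) - G t)).
    apply/funext => h /=; congr (_ *: (G _ - _)).
    by rewrite addrC; congr (_ + _); rewrite /GRing.scale/= mulr1.
  exact: Gd.
have Gc : forall t : R, 0 <= t -> {for t, continuous G}.
  move=> t t0; have [Gd _] := GD t t0.
  by apply: differentiable_continuous; apply/derivable1_diffP.
split=> // [t|t t0].
  have [t0|t0] := leP t 0.
    rewrite F0//; apply: cvg_near_cst; near=> s; apply: F0.
    apply: le_trans t0; near: s; exact: nbhs_left_le.
  rewrite FG ?ltW//.
  have : G s - G 0 @[s --> t^'-] --> G t - G 0.
    apply: cvgB; last exact: cvg_cst.
    by apply: cvg_at_left_filter; apply: Gc; exact: ltW.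
  apply: cvg_trans; apply: near_eq_cvg; near=> s; rewrite FG//.
  by near: s; exact: nbhs_left_ge.
apply: (@right_derivative_eq _ _ (fun t => G t - G 0)).
- by rewrite FG.
- near=> s; rewrite FG// (le_trans t0)//; near: s; exact: nbhs_right_ge.
- rewrite -[f t]subr0; apply: right_derivativeB; last exact: right_derivative_cst.
  by have := GR t t0; rewrite /g max_l.
Unshelve. all: by end_near. Qed.

(** * The delay operator *)

(** An operator norm bound of [delay_rhs]; the factor n is there because the
    maximum norm is submultiplicative only up to the inner dimension. *)
Definition delay_norm (R : realType) (n m : nat) (A0 : 'M[R]_n)
    (A : 'I_m -> 'M[R]_n) : R := n%:R * (`|A0| + \sum_(j < m) `|A j|).

Lemma delay_norm_ge0 (R : realType) (n m : nat) (A0 : 'M[R]_n)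
  (A : 'I_m -> 'M[R]_n) : 0 <= delay_norm A0 A.
Proof. by rewrite mulr_ge0// addr_ge0// sumr_ge0. Qed.

Lemma delay_rhs_norm_le (R : realType) (n m p : nat) (A0 : 'M[R]_n)
    (A : 'I_m -> 'M[R]_n) (tau : 'I_m -> R) (Y : R -> 'M[R]_(n, p)) (t c : R) :
    `|Y t| <= c -> (forall j, `|Y (t - tau j)| <= c) ->
  `|delay_rhs A0 A tau Y t| <= delay_norm A0 A * c.
Proof.
move=> Y0 Yj; rewrite /delay_rhs /delay_norm mulrDr mulrDl.
have mul_le (B : 'M[R]_n) (C : 'M[R]_(n, p)) :
    `|C| <= c -> `|B *m C| <= n%:R * `|B| * c.
  by move=> Cc; apply: (le_trans (mx_norm_mulmx _ _)); rewrite ler_wpM2l// mulr_ge0.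
apply: (le_trans (ler_normD _ _)); apply: lerD; first exact: mul_le.
apply: (le_trans (ler_norm_sum _ _ _)); rewrite mulr_sumr mulr_suml.
by apply: ler_sum => j _; exact: mul_le.
Qed.

Lemma delay_rhsB (R : realType) (n m p : nat) (A0 : 'M[R]_n)
    (A : 'I_m -> 'M[R]_n) (tau : 'I_m -> R) (Y Z : R -> 'M[R]_(n, p)) (t : R) :
  delay_rhs A0 A tau (fun s => Y s - Z s) t =
  delay_rhs A0 A tau Y t - delay_rhs A0 A tau Z t.
Proof.
rewrite /delay_rhs mulmxBr opprD addrACA -sumrB; congr (_ + _).
by apply: eq_bigr => j _; rewrite mulmxBr.
Qed.

Lemma delay_rhsD (R : realType) (n m p : nat) (A0 : 'M[R]_n)
    (A : 'I_m -> 'M[R]_n) (tau : 'I_m -> R) (Y Z : R -> 'M[R]_(n, p)) (t : R) :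
  delay_rhs A0 A tau (fun s => Y s + Z s) t =
  delay_rhs A0 A tau Y t + delay_rhs A0 A tau Z t.
Proof.
rewrite /delay_rhs mulmxDr addrACA -big_split; congr (_ + _).
by apply: eq_bigr => j _; rewrite mulmxDr.
Qed.

Lemma delay_rhs_sum (R : realType) (n m p k : nat) (A0 : 'M[R]_n)
    (A : 'I_m -> 'M[R]_n) (tau : 'I_m -> R) (Y : 'I_k -> R -> 'M[R]_(n, p))
    (t : R) :
  delay_rhs A0 A tau (fun s => \sum_i Y i s) t =
  \sum_i delay_rhs A0 A tau (Y i) t.
Proof.
rewrite /delay_rhs big_split mulmx_sumr; congr (_ + _).
by rewrite exchange_big; apply: eq_bigr => j _; rewrite mulmx_sumr.
Qed.

Lemma delay_rhs_mulmxr (R : realType) (n m p q : nat) (A0 : 'M[R]_n)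
    (A : 'I_m -> 'M[R]_n) (tau : 'I_m -> R) (Y : R -> 'M[R]_(n, p))
    (C : 'M[R]_(p, q)) (t : R) :
  delay_rhs A0 A tau (fun s => Y s *m C) t = delay_rhs A0 A tau Y t *m C.
Proof.
rewrite /delay_rhs mulmxDl mulmx_suml mulmxA; congr (_ + _).
by apply: eq_bigr => j _; rewrite mulmxA.
Qed.

Lemma delay_rhs_shift (R : realType) (n m p : nat) (A0 : 'M[R]_n)
    (A : 'I_m -> 'M[R]_n) (tau : 'I_m -> R) (Y : R -> 'M[R]_(n, p)) (c t : R) :
  delay_rhs A0 A tau (fun s => Y (s + c)) t = delay_rhs A0 A tau Y (t + c).
Proof.
rewrite /delay_rhs; congr (_ + _).
by apply: eq_bigr => j _; rewrite addrAC.
Qed.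

Lemma max_delay_ge (R : realType) (m : nat) (tau : 'I_m -> R) (j : 'I_m) :
  tau j <= max_delay tau.
Proof. by apply/bigmax_geP; right; exists j. Qed.

Lemma max_delay_ge0 (R : realType) (m : nat) (tau : 'I_m -> R) :
  0 <= max_delay tau.
Proof. by apply/bigmax_geP; left. Qed.

Lemma max_delay_window (R : realType) (m : nat) (tau : 'I_m -> R) (j : 'I_m)
    (s : R) : 0 <= s <= tau j -> - max_delay tau <= s - tau j <= 0.
Proof.
move=> /andP[s0 sj]; rewrite subr_le0 sj andbT lerBrDr (le_trans _ s0)//.
by rewrite addrC subr_le0 max_delay_ge.
Qed.

Lemma within_cvg_left (R : realType) (V : normedModType R) (f : R -> V)
    (a b t : R) : {within `[a, b], continuous f} -> a < t <= b ->
  f s @[s --> t^'-] --> f t.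
Proof.
move=> /subspace_continuousP fc /andP[a_t tb].
have := fc t; rewrite /= in_itv/= (ltW a_t) tb => /(_ isT).
apply: cvg_trans; apply: cvg_app => B; rewrite !nbhs_simpl/= => -[e/= e0 H].
near=> s; apply: H => //=.
  near: s; apply: cvgr_dist_lt => //; apply: cvg_at_left_filter; exact: cvg_id.
have st : s < t by near: s; exact: nbhs_left_lt.
rewrite in_itv/= (le_trans (ltW st) tb) andbT.
by near: s; exact: nbhs_left_ge.
Unshelve. all: by end_near. Qed.

Lemma within_cvg_right (R : realType) (V : normedModType R) (f : R -> V)
    (a b t : R) : {within `[a, b], continuous f} -> a <= t < b ->
  f s @[s --> t^'+] --> f t.
Proof.
move=> /subspace_continuousP fc /andP[a_t tb].
have := fc t; rewrite /= in_itv/= (ltW tb) a_t => /(_ isT).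
apply: cvg_trans; apply: cvg_app => B; rewrite !nbhs_simpl/= => -[e/= e0 H].
near=> s; apply: H => //=.
  near: s; apply: cvgr_dist_lt => //; apply: cvg_at_right_filter; exact: cvg_id.
have st : t < s by near: s; exact: nbhs_right_gt.
rewrite in_itv/= (le_trans a_t (ltW st)) /=.
by near: s; exact: nbhs_right_le.
Unshelve. all: by end_near. Qed.

Lemma within_ray_cvg_left (R : realType) (V : normedModType R) (f : R -> V)
    (a t : R) : {within `[a, +oo[, continuous f} -> a < t ->
  f s @[s --> t^'-] --> f t.
Proof.
move=> fc a_t; apply: (@within_cvg_left _ _ _ a t); last by rewrite a_t lexx.
apply: continuous_subspaceW fc => s /=; rewrite !in_itv/= => /andP[-> _] //.
Qed.

(** The bounding function u satisfies u' = (K + 2) u with K = [delay_norm],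
    while at the first time at which |z| reaches u the derivative of z is at most
    K u + eps <= (K + 1) u, because u is nondecreasing and at least eps. *)
Lemma delay_gronwall (R : realType) (n m p : nat) (A0 : 'M[R]_n)
    (A : 'I_m -> 'M[R]_n) (tau : 'I_m -> R) (z z' : R -> 'M[R]_(n, p))
    (eps : R) :
    (forall j, 0 <= tau j) -> 0 < eps ->
    (forall t, t <= 0 -> z t = 0) ->
    (forall t, 0 < t -> z s @[s --> t^'-] --> z t) ->
    (forall t, 0 <= t -> right_derivative z t (z' t)) ->
    (forall t, 0 <= t -> `|z' t - delay_rhs A0 A tau z t| <= eps) ->
  forall t, 0 <= t -> `|z t| <= eps * expR ((delay_norm A0 A + 2) * t).
Proof.
move=> tau0 e0 z0 zl zd zr T T0.
set K := delay_norm A0 A; have K0 : 0 <= K := delay_norm_ge0 A0 A.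
pose u t := eps * expR ((K + 2) * t).
have u0 t : 0 < u t by rewrite mulr_gt0// expR_gt0.
have u_le s t : s <= t -> u s <= u t.
  by move=> st; rewrite ler_pM2l// ler_expR ler_wpM2l// addr_ge0.
apply: (@comparison R _ z u 0 T); last by rewrite T0 lexx.
- by move=> t /andP[t0 _]; exact: zl.
- move=> t _; apply: cvg_at_left_filter; apply: cvgM; first exact: cvg_cst.
  apply: continuous_cvg; first exact: continuous_expR.
  by apply: cvgM; [exact: cvg_cst|exact: cvg_id].
- by rewrite z0// normr0 ltW.
move=> t /andP[t0 _] IH.
have zu s : s <= t -> `|z s| <= u t.
  move=> st; have [s0|s0] := leP s 0; first by rewrite z0// normr0 ltW.
  by apply: (le_trans (IH s _)); [rewrite ltW|exact: u_le].
have zt : `|z' t| < (K + 2) * u t.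
  have H : `|delay_rhs A0 A tau z t| <= K * u t.
    by apply: delay_rhs_norm_le => [|j]; apply: zu => //; rewrite gerDl oppr_le0.
  have -> : z' t = (z' t - delay_rhs A0 A tau z t) + delay_rhs A0 A tau z t.
    by rewrite subrK.
  apply: (le_lt_trans (ler_normD _ _)).
  have := zr t t0; have := u0 t.
  have : eps <= u t by rewrite ler_pMr// -expR0 ler_expR mulr_ge0// addr_ge0.
  rewrite mulrDl; lra.
near=> h.
have h0 : 0 < h by near: h; exact: nbhs_right_gt.
have H : `|z (t + h) - z t| <= ((K + 2) * u t) * h.
  by near: h; exact: right_derivative_norm_le (zd t t0) zt.
apply: (le_trans H).
have -> : u (t + h) - u t = u t * (expR ((K + 2) * h) - 1).
  by rewrite /u mulrDr expRD; ring.
rewrite mulrAC mulrC ler_pM2l//.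
by rewrite lerBrDl expR_ge1Dx.
Unshelve. all: by end_near. Qed.

(** * The primitive of the fundamental matrix *)

(** These are the properties of the integral P of X from 0 that are used below.
    The last one is the integrated equation of X; the indicator of [0, +oo[
    accounts for the jump of X at 0. *)
Definition is_fundamental_primitive (R : realType) (n m : nat) (A0 : 'M[R]_n)
    (A : 'I_m -> 'M[R]_n) (tau : 'I_m -> R) (X P : R -> 'M[R]_n) : Prop :=
  [/\ forall t, t <= 0 -> P t = 0,
      forall t, P s @[s --> t^'-] --> P t,
      forall t, right_derivative P t (X t)
    & forall t, X t = (0 <= t)%R%:R%:M + delay_rhs A0 A tau P t].

Lemma cvg_left_delay_rhs (R : realType) (n m p : nat) (A0 : 'M[R]_n)
    (A : 'I_m -> 'M[R]_n) (tau : 'I_m -> R) (Y : R -> 'M[R]_(n, p)) (t : R) :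
    Y s @[s --> t^'-] --> Y t ->
    (forall j, Y s @[s --> (t - tau j)^'-] --> Y (t - tau j)) ->
  delay_rhs A0 A tau Y s @[s --> t^'-] --> delay_rhs A0 A tau Y t.
Proof.
move=> Yt Yj; apply: cvgD; first exact: cvg_mulmxl.
apply: cvg_big => [|j _]; first exact: add_continuous.
by apply: cvg_mulmxl; exact: cvg_left_shift.
Qed.

Lemma right_derivative_delay_rhs (R : realType) (n m p : nat) (A0 : 'M[R]_n)
    (A : 'I_m -> 'M[R]_n) (tau : 'I_m -> R) (Y Y' : R -> 'M[R]_(n, p)) (t : R) :
    right_derivative Y t (Y' t) ->
    (forall j, right_derivative Y (t - tau j) (Y' (t - tau j))) ->
  right_derivative (delay_rhs A0 A tau Y) t (delay_rhs A0 A tau Y' t).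
Proof.
move=> Yt Yj; apply: right_derivativeD; first exact: right_derivative_mulmxl.
apply: right_derivative_sum => j; apply: right_derivative_mulmxl.
exact: right_derivative_shift.
Qed.

(** For the integrated equation: X and the delay operator applied to P have the
    same right derivative on [0, +oo[, so their difference keeps the value 1
    that it has at 0. *)
Lemma fundamental_primitive (R : realType) (n m : nat) (A0 : 'M[R]_n)
    (A : 'I_m -> 'M[R]_n) (tau : 'I_m -> R) (X : R -> 'M[R]_n) :
    (forall j, 0 < tau j) -> is_fundamental_matrix A0 A tau X ->
  exists P, is_fundamental_primitive A0 A tau X P.
Proof.
move=> tau0 [Xc Xd Xn X1].
pose P t : 'M[R]_n :=
  \matrix_(i, j) \int[@lebesgue_measure R]_(s in `[0, t]) X s i j.
have entry i j := @integral_right_primitive R (fun s => X s i j).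
have Xij i j : {within `[0, +oo[, continuous (fun s => X s i j)}.
  apply/subspace_continuousP => t t0.
  by have /subspace_continuousP/(_ t t0)/cvg_mx_entry := Xc; apply.
have P0 t : t <= 0 -> P t = 0.
  move=> t0; apply/matrixP => i j; rewrite !mxE.
  by have [-> //] := entry i j (Xij i j).
have Pl t : P s @[s --> t^'-] --> P t.
  apply/cvg_mx_entry => i j; rewrite mxE; under eq_fun do rewrite mxE.
  by have [_ + _] := entry i j (Xij i j); apply.
have Pd t : right_derivative P t (X t).
  have [t0|t0] := leP 0 t.
    apply/cvg_mx_entry => i j; under eq_fun do rewrite !mxE.
    by have [_ _] := entry i j (Xij i j); apply.
  rewrite Xn//; apply: (@right_derivative_eq _ _ (fun=> 0)).
  - by rewrite P0// ltW.
  - by near=> s; rewrite P0//; near: s; exact: nbhs_right_le.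
  - exact: right_derivative_cst.
exists P; split=> // t.
have LP0 s : s <= 0 -> delay_rhs A0 A tau P s = 0.
  move=> s0; rewrite /delay_rhs P0// mulmx0 add0r big1// => j _.
  by rewrite P0 ?mulmx0// subr_le0 (le_trans s0)// ltW.
have [t0|t0] := leP 0 t; last by rewrite Xn// LP0 ?ltW// -scalemx1 scale0r addr0.
pose f s := X s - delay_rhs A0 A tau P s.
suff : `|f t - f 0| <= (0 : R) - 0.
  rewrite subrr normr_le0 subr_eq0 {2}/f X1 LP0// subr0 => /eqP <-.
  by rewrite /f subrK.
apply: (@mean_value_right _ _ f (fun=> 0) (fun=> 0) (fun=> 0) 0 t t0).
- move=> s /andP[s0 _]; apply: cvgB; first exact: within_ray_cvg_left Xc _.
  by apply: cvg_left_delay_rhs.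
- by move=> s _; exact: cvg_cst.
- move=> s /andP[s0 _]; rewrite -(subrr (delay_rhs A0 A tau X s)).
  apply: right_derivativeB; first exact: Xd.
  by apply: right_derivative_delay_rhs.
- by move=> s _; exact: right_derivative_cst.
- by move=> s _; rewrite normr0.
Unshelve. all: by end_near. Qed.

(** * Approximate variation of constants *)

(** W stands for the convolution of X with g restricted to [0, b[, and d for a
    bound of g: the equation of W is the one of that convolution with g
    replaced by a function r that differs from it by at most eps.  The error is
    required to vanish outside [0, b[ so that it does not accumulate when b is
    increased step by step. *)
Definition duhamel_approx (R : realType) (n m p : nat) (A0 : 'M[R]_n)
    (A : 'I_m -> 'M[R]_n) (tau : 'I_m -> R) (X : R -> 'M[R]_n)
    (g : R -> 'M[R]_(n, p)) (d eps b : R) : Prop :=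
  exists W r : R -> 'M[R]_(n, p),
    [/\ forall t, t <= 0 -> W t = 0,
        forall t, W s @[s --> t^'-] --> W t,
        forall t, right_derivative W t (delay_rhs A0 A tau W t + r t),
        forall t, `|r t - (if 0 <= t < b then g t else 0)| <=
          (if 0 <= t < b then eps else 0)
      & forall t rho, (forall s, t - b <= s <= t -> `|X s| <= rho) ->
          `|W t| <= n%:R * rho * d * b].

(** On [b, c[ the function g is replaced by the constant g b, whose response is
    (P (t - b) - P (t - c)) *m g b.  This response is bounded by the mean value
    inequality since P has the derivative X. *)
Lemma duhamel_approx_step (R : realType) (n m p : nat) (A0 : 'M[R]_n)
    (A : 'I_m -> 'M[R]_n) (tau : 'I_m -> R) (X P : R -> 'M[R]_n)
    (g : R -> 'M[R]_(n, p)) (d eps b c : R) :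
    is_fundamental_primitive A0 A tau X P ->
    0 <= b <= c -> `|g b| <= d ->
    (forall s, b <= s < c -> `|g s - g b| <= eps) ->
  duhamel_approx A0 A tau X g d eps b -> duhamel_approx A0 A tau X g d eps c.
Proof.
move=> [P0 Pl Pd PX] /andP[b0 bc] gb gbc [W [r [W0 Wl Wd Wr WX]]].
exists (fun t => W t + (P (t - b) - P (t - c)) *m g b).
exists (fun t => r t + (b <= t < c)%R%:R *: g b).
split=> [t t0|t|t|t|t rho Xrho].
- by rewrite W0// !P0 ?subrr ?mul0mx ?addr0// subr_le0 (le_trans t0)// (le_trans b0).
- apply: cvgD; first exact: Wl.
  by apply: cvg_mulmxr; apply: cvgB; exact: cvg_left_shift.
- rewrite delay_rhsD addrACA; apply: right_derivativeD; first exact: Wd.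
  rewrite delay_rhs_mulmxr delay_rhsB !delay_rhs_shift.
  have -> : (delay_rhs A0 A tau P (t - b) - delay_rhs A0 A tau P (t - c)) *m g b
    + (b <= t < c)%R%:R *: g b = (X (t - b) - X (t - c)) *m g b.
    rewrite !PX.
    move: (delay_rhs A0 A tau P (t - b)) (delay_rhs A0 A tau P (t - c)) => L1 L2.
    rewrite opprD addrACA [in RHS]mulmxDl [LHS]addrC; congr (_ + _).
    rewrite -mul_scalar_mx -raddfB; congr (_%:M *m _).
    rewrite !subr_ge0 ltNge; have [ct|_] := leP c t; rewrite ?andbF ?andbT ?subr0//.
    by rewrite (le_trans bc ct) subrr.
  apply: right_derivative_mulmxr; apply: right_derivativeB.
    exact: right_derivative_shift.
  exact: right_derivative_shift.
- have := Wr t; have [tb|bt] := ltP t b.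
    by rewrite (lt_le_trans tb bc) /= scale0r addr0.
  rewrite !(le_trans b0 bt)/= subr0 normr_le0 => /eqP ->; rewrite add0r.
  have [tc|_] := ltP t c; last by rewrite scale0r subr0 normr0.
  by rewrite scale1r distrC gbc// bt.
- have H : `|P (t - b) - P (t - c)| <= (t - b) * rho - (t - c) * rho.
    apply: (@mean_value_right _ _ P X (fun s => s * rho) (fun=> rho)).
    + by rewrite lerD2l lerN2.
    + by move=> s _; exact: Pl.
    + move=> s _; apply: cvg_at_left_filter.
      by apply: cvgM; [exact: cvg_id|exact: cvg_cst].
    + by move=> s _; exact: Pd.
    + by move=> s _; exact: right_derivative_linear.
    + move=> s /andP[cs sb]; apply: Xrho; rewrite cs (le_trans (ltW sb))//.
      by rewrite gerDl oppr_le0.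
  have W1 : `|W t| <= n%:R * rho * d * b.
    apply: WX => s /andP[bs st]; apply: Xrho; rewrite st andbT.
    by apply: le_trans bs; rewrite lerD2l lerN2.
  apply: (le_trans (ler_normD _ _)).
  have := le_trans (mx_norm_mulmx (P (t - b) - P (t - c)) (g b))
    (ler_pM _ _ (ler_wpM2l (ler0n R n) H) gb).
  move=> /(_ (mulr_ge0 _ _)) H2.
  have {}H2 : `|(P (t - b) - P (t - c)) *m g b| <=
     n%:R * ((t - b) * rho - (t - c) * rho) * d by apply: H2.
  by apply: (le_trans (lerD W1 H2)); rewrite le_eqVlt; apply/orP; left; apply/eqP; ring.
Qed.

(** Real induction on b replaces the choice of a partition on whose intervals g
    oscillates by at most eps: near each point one more step is enough, to the
    right because g is right continuous, and up to the point from some r before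
    it because g is left continuous. *)
Lemma duhamel_approx_exists (R : realType) (n m p : nat) (A0 : 'M[R]_n)
    (A : 'I_m -> 'M[R]_n) (tau : 'I_m -> R) (X P : R -> 'M[R]_n)
    (g : R -> 'M[R]_(n, p)) (d eps b : R) :
    is_fundamental_primitive A0 A tau X P -> 0 <= b -> 0 < eps ->
    {within `[0, b], continuous g} ->
    (forall s, 0 <= s <= b -> `|g s| <= d) ->
  duhamel_approx A0 A tau X g d eps b.
Proof.
move=> HP b0 e0 gc gd.
apply: (@real_induction R 0 b); last by rewrite b0 lexx.
- exists (fun=> 0), (fun=> 0); split=> [//|t|t|t|t rho _].
  + exact: cvg_cst.
  + rewrite addr0 /delay_rhs mulmx0 add0r big1 => [|j _]; last by rewrite mulmx0.
    exact: right_derivative_cst.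
  + by case: ifP => [/andP[t0]|_]; [rewrite ltNge t0|rewrite subr0 normr0].
  + by rewrite normr0 mulr0.
- move=> t tb IH; have t0 : 0 <= t by case/andP: tb.
  have /cvgrPdist_le/(_ eps e0) := within_cvg_right gc tb.
  move=> [e/= e_gt0 He].
  near=> s.
  have ts : t < s by near: s; exact: nbhs_right_gt.
  apply: (duhamel_approx_step HP (b := t)).
  + by rewrite t0 ltW.
  + by apply: gd; case/andP: tb => -> /ltW.
  + move=> r /andP[]; rewrite le_eqVlt => /predU1P[<- _|tr rs].
      by rewrite subrr normr0 ltW.
    rewrite distrC; apply: He => //=.
    rewrite distrC gtr0_norm ?subr_gt0//; apply: (le_lt_trans (lerB (ltW rs) (lexx t))).
    by near: s; exact: nbhs_right_ltDr.
  + by apply: IH; rewrite t0 lexx.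
- move=> t tb IH; have /andP[t0 tb'] := tb.
  have /cvgrPdist_le/(_ (eps / 2)) := within_cvg_left gc tb.
  rewrite divr_gt0// => /(_ isT)[e/= e_gt0 He].
  pose r := Num.max 0 (t - e / 2).
  have rt : r < t by rewrite gt_max t0 gtrBl divr_gt0.
  have r0 : 0 <= r by rewrite le_max lexx.
  have near_t s : r <= s < t -> `|g t - g s| <= eps / 2.
    move=> /andP[rs st]; apply: He => //=; rewrite gtr0_norm ?subr_gt0//.
    have : t - e / 2 <= s by apply: le_trans rs; rewrite le_max lexx orbT.
    lra.
  apply: (duhamel_approx_step HP (b := r)).
  + by rewrite r0 ltW.
  + by apply: gd; rewrite r0 (le_trans (ltW rt)).
  + move=> s rst.
    have -> : g s - g r = (g t - g r) - (g t - g s).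
      by rewrite opprB [RHS]addrC subrKA.
    rewrite (le_trans (ler_normB _ _))// [leRHS]splitr lerD// near_t//.
    by rewrite lexx rt.
  + by apply: IH; rewrite r0.
Unshelve. all: by end_near. Qed.

(** * The fundamental estimate *)

(** On [0, +oo[ the solution x differs from X(t) phi(0) by a function that starts from 0 and is driven by the terms
    A_j phi(t - tau_j), t < tau_j, through which the initial function acts.
    Approximate convolutions W_j with these terms therefore make up the rest of
    x, up to a function z to which [delay_gronwall] applies.  As t is fixed, eps
    can be taken so small that |z t| <= eta. *)
Lemma solution_norm_le (R : realType) (n m : nat) (A0 : 'M[R]_n)
    (A : 'I_m -> 'M[R]_n) (tau : 'I_m -> R) (X : R -> 'M[R]_n) :
    (forall j, 0 < tau j) -> is_fundamental_matrix A0 A tau X ->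
  exists2 C : R, 0 < C & forall (phi x : R -> 'cV[R]_n) (d rho t : R),
    {within `[- max_delay tau, 0], continuous phi} ->
    (forall s, - max_delay tau <= s <= 0 -> `|phi s| <= d) ->
    is_solution A0 A tau phi x ->
    0 <= t -> (forall s, t - max_delay tau <= s <= t -> `|X s| <= rho) ->
    `|x t| <= C * rho * d.
Proof.
move=> tau0 HX; have [P HP] := fundamental_primitive tau0 HX.
have [Xc Xd Xn X1] := HX.
exists (n%:R + 1 + \sum_(j < m) n%:R * (n%:R * `|A j|) * tau j).
  apply: ltr_wpDr; last by rewrite ltr_wpDl.
  by apply: sumr_ge0 => j _; rewrite !mulr_ge0// ltW.
move=> phi x d rho t phic phid [xphi xc xd] t0 Xrho.
set h := max_delay tau in phic phid xphi Xrho.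
have h0 : 0 <= h := max_delay_ge0 tau.
have d0 : 0 <= d.
  by apply: le_trans (phid 0 _); rewrite ?normr_ge0// oppr_le0 h0 lexx.
have rho0 : 0 <= rho.
  by apply: le_trans (Xrho t _); rewrite ?normr_ge0// gerDl oppr_le0 h0 lexx.
have x0 : x 0 = phi 0 by apply: xphi; rewrite oppr_le0 h0 lexx.
apply/ler_addgt0Pr => eta eta0.
set K := delay_norm A0 A.
pose eps := eta / (m.+1%:R * expR ((K + 2) * t)).
have eps0 : 0 < eps by rewrite divr_gt0// mulr_gt0// expR_gt0.
have approx j : duhamel_approx A0 A tau X
    (fun s => A j *m phi (s - tau j)) (n%:R * `|A j| * d) eps (tau j).
  apply: (duhamel_approx_exists HP) => // [||s /andP[s0 sj]]; first exact: ltW.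
    apply/subspace_continuousP => s /=; rewrite in_itv/= => /andP[s0 sj].
    apply: cvg_mulmxl.
    have sjh : - h <= s - tau j <= 0 by apply: max_delay_window; rewrite s0.
    have /subspace_continuousP/(_ (s - tau j)) := phic.
    rewrite /= in_itv/= => /(_ sjh).
    move=> H; apply: (@cvg_comp _ _ _ (fun r => r - tau j) phi _ _ _ _ H).
    move=> B [e/= e0 HB]; exists e => //= r re; rewrite in_itv/= => /andP[r0 rj].
    apply: HB => /=; first by rewrite opprB addrA subrK.
    by rewrite in_itv/=; apply: max_delay_window; rewrite r0.
  apply: (le_trans (mx_norm_mulmx _ _)); rewrite ler_wpM2l ?mulr_ge0//.
  by apply: phid; apply: max_delay_window; rewrite s0.
have [W {}approx] := choice approx; have [r {}approx] := choice approx.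
pose y s := x s - X s *m phi 0 - \sum_j W j s.
(* the delay operator at s < tau j sees the values of z left of 0, where y is
   the initial function and must be replaced by 0 *)
pose z s := if 0 <= s then y s else 0.
have W0 j s : s <= 0 -> W j s = 0 by have [+ _ _ _ _] := approx j; apply.
have z0 s : s <= 0 -> z s = 0.
  rewrite /z le_eqVlt => /predU1P[->|]; last by rewrite ltNge => /negbTE ->.
  rewrite lexx /y x0 X1 mul1mx subrr sub0r big1 ?oppr0// => j _.
  by rewrite W0.
have zy s : 0 <= s -> z s = y s by rewrite /z => ->.
have yd s : 0 <= s ->
    right_derivative y s (delay_rhs A0 A tau y s - \sum_j r j s).
  move=> s0; rewrite /y !delay_rhsB delay_rhs_mulmxr delay_rhs_sum.
  rewrite -[X in right_derivative _ _ X]addrA -opprD -big_split.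
  apply: right_derivativeB.
    apply: right_derivativeB; first exact: xd.
    by apply: right_derivative_mulmxr; exact: Xd.
  by apply: right_derivative_sum => j; have [_ _ + _ _] := approx j; apply.
have zt : `|z t| <= (m.+1%:R * eps) * expR ((K + 2) * t).
  apply: (@delay_gronwall _ _ _ _ A0 A tau z
    (fun s => delay_rhs A0 A tau y s - \sum_j r j s)) => //.
  - by move=> j; exact: ltW.
  - by rewrite mulr_gt0.
  - move=> s s0; rewrite zy ?ltW//.
    have : y r @[r --> s^'-] --> y s.
      apply: cvgB; first apply: cvgB.
      + exact: within_ray_cvg_left xc s0.
      + by apply: cvg_mulmxr; exact: within_ray_cvg_left Xc s0.
      + apply: cvg_big => [|j _]; first exact: add_continuous.
        by have [_ + _ _ _] := approx j; apply.
    apply: cvg_trans; apply: near_eq_cvg; near=> q; rewrite zy//.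
    by near: q; exact: nbhs_left_ge.
  - move=> s s0; apply: right_derivative_eq (yd s s0); first by rewrite zy.
    near=> q; rewrite zy// (le_trans s0)//; near: q; exact: nbhs_right_ge.
  - move=> s s0; rewrite addrAC /delay_rhs zy// opprD addrACA subrr add0r.
    rewrite -!sumrB; apply: (le_trans (ler_norm_sum _ _ _)).
    have -> : m.+1%:R * eps = \sum_(j < m) eps + eps.
      by rewrite big_const_ord iter_addr addr0 -natr1 mulrDl mul1r mulr_natl.
    apply: ler_wpDr; first exact: ltW.
    apply: ler_sum => j _.
    have [_ _ _ + _] := approx j => /(_ s); rewrite s0/=.
    have [sj|js] := ltP s (tau j); last first.
      rewrite subr0 normr_le0 => /eqP ->.
      by rewrite zy ?subr_ge0// subrr subr0 normr0 ltW.
    have sj0 : s - tau j < 0 by rewrite subr_lt0.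
    rewrite (z0 (s - tau j) (ltW sj0)) mulmx0 subr0 distrC /y Xn// mul0mx subr0.
    rewrite big1 ?subr0 => [|i _]; last by rewrite W0// ltW.
    by rewrite xphi//; apply: max_delay_window; rewrite s0 ltW.
have -> : x t = (X t *m phi 0 + \sum_j W j t) + z t.
  by rewrite zy// /y -[x t - _ - _]addrA -opprD [RHS]addrC subrK.
apply: (le_trans (ler_normD _ _)); apply: lerD; last first.
  apply: (le_trans zt); rewrite /eps mulrAC mulrCA mulfV ?mulr1//.
  by rewrite mulf_neq0// gt_eqF// expR_gt0.
apply: (le_trans (ler_normD _ _)).
rewrite -mulrA mulrDl; apply: lerD.
  apply: (le_trans (mx_norm_mulmx _ _)).
  apply: (@le_trans _ _ (n%:R * (rho * d))).
    rewrite -mulrA ler_wpM2l// ler_pM//; first apply: Xrho.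
      by rewrite lexx gerDl oppr_le0 h0.
    by apply: phid; rewrite oppr_le0 h0 lexx.
  by rewrite ler_wpM2r ?mulr_ge0// lerDl.
apply: (le_trans (ler_norm_sum _ _ _)); rewrite mulr_suml; apply: ler_sum => j _.
have [_ _ _ _ Wj] := approx j.
have -> : n%:R * (n%:R * `|A j|) * tau j * (rho * d) =
  n%:R * rho * (n%:R * `|A j| * d) * tau j by ring.
apply: Wj => s /andP[ts st]; apply: Xrho; rewrite st andbT.
by apply: le_trans ts; rewrite lerD2l lerN2 max_delay_ge.
Unshelve. all: by end_near. Qed.

(** * Equivalence of matrix norms *)

Lemma lipschitz_bound_continuous (R : realType) (V W : normedModType R)
    (f : V -> W) (c : R) :
  (forall v w, `|f v - f w| <= c * `|v - w|) -> continuous f.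
Proof.
move=> fL v; apply/cvgrPdist_le => e e0.
have c0 : 0 < `|c| + 1 by rewrite ltr_wpDl.
apply/nbhs_normP; exists (e / (`|c| + 1)); first exact: divr_gt0.
move=> w /= /ltW; rewrite ler_pdivlMr// => vw; apply: le_trans vw.
rewrite (le_trans (fL _ _))// mulrC ler_wpM2l//.
by rewrite (le_trans (ler_norm c))// lerDl.
Qed.

(** The upper bound comes from the expansion in the canonical basis; it makes N
    continuous, so N attains on the compact unit sphere a minimum, which is
    positive.  Matrices are flattened to row vectors so that
    [bounded_closed_compact] gives the compactness of the sphere. *)
Lemma matrix_norm_equiv (R : realType) (n : nat) (N : 'M[R]_n -> R) :
    is_matrix_norm N ->
  exists C : R, [/\ 0 < C, forall B, `|B| <= C * N B & forall B, N B <= C * `|B|].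
Proof.
move=> [N_eq0 NZ ND].
have N0 : N 0 = 0 by rewrite -(scale0r (0 : 'M[R]_n)) NZ normr0 mul0r.
have NN B : N (- B) = N B by rewrite -scaleN1r NZ normrN1 mul1r.
have Nge0 B : 0 <= N B.
  by have := ND B (- B); rewrite subrr N0 NN -mulr2n pmulrn_lge0.
pose c1 := \sum_(i < n) \sum_(j < n) N (delta_mx i j).
have c1_ge0 : 0 <= c1 by apply: sumr_ge0 => i _; apply: sumr_ge0.
have Nsum (I : finType) (F : I -> 'M[R]_n) : N (\sum_i F i) <= \sum_i N (F i).
  elim/big_ind2: _ => [|B b B' b' Bb Bb'|//]; first by rewrite N0.
  by apply: (le_trans (ND _ _)); exact: lerD.
have upper B : N B <= c1 * `|B|.
  rewrite [in leLHS](matrix_sum_delta B) (le_trans (Nsum _ _))//.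
  rewrite /c1 mulr_suml ler_sum// => i _; rewrite (le_trans (Nsum _ _))//.
  rewrite mulr_suml ler_sum// => j _.
  by rewrite NZ mulrC ler_wpM2l// mx_norm_entry.
pose f (v : 'rV[R]_(n * n)) := N (vec_mx v).
have fL v w : `|f v - f w| <= c1 * `|v - w|.
  have fle v' w' : f v' - f w' <= c1 * `|v' - w'|.
    rewrite lerBlDr /f -[in leLHS](subrK w' v') linearD.
    rewrite (le_trans (ND _ _))// lerD2r (le_trans (upper _))// ler_wpM2l//.
    apply: mx_norm_le => // i j; rewrite mxE; exact: mx_norm_entry.
  by rewrite ler_norml lerNl opprB fle distrC fle.
have fc : continuous f by exact: lipschitz_bound_continuous fL.
pose S := [set v : 'rV[R]_(n * n) | `|v| = 1].
have cS : compact S.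
  apply: bounded_closed_compact.
    exists 1; split => // M M1 v /= ->; exact: ltW.
  apply: (@preimage_closed _ _ (fun v : 'rV[R]_(n * n) => `|v|) [set x : R | x = 1]).
    by move=> v _; exact: norm_continuous.
  exact: closed_eq.
have lower : exists2 c, 0 < c & forall v, c * `|v| <= f v.
  have [S0|S_neq0] := pselect (S !=set0); last first.
    exists 1 => // v; rewrite mul1r.
    have [->|v0] := eqVneq v 0; first by rewrite normr0 /f.
    exfalso; apply: S_neq0; exists (`|v|^-1 *: v).
    by rewrite /S/= normrZ normfV normr_id mulVf// normr_eq0.
  have [v0 /set_mem v0S vmin] := EVT_min_rV S0 cS (continuous_subspaceT fc).
  exists (f v0).
    rewrite lt_neqAle Nge0 andbT eq_sym; apply/eqP => /N_eq0 /eqP.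
    rewrite vec_mx_eq0 => /eqP v00; move: v0S; rewrite /S/= v00 normr0 => /eqP.
    by rewrite eq_sym oner_eq0.
  move=> v; have [->|v_neq0] := eqVneq v 0; first by rewrite normr0 mulr0 /f.
  have vp : 0 < `|v| by rewrite normr_gt0.
  have /vmin : `|v|^-1 *: v \in S.
    by rewrite inE /S/= normrZ normfV normr_id mulVf// normr_eq0.
  by rewrite [leRHS]/f linearZ NZ normfV normr_id ler_pdivlMl// mulrC.
have [c c0 fge] := lower.
exists (c^-1 + c1); split=> [|B|B].
- by rewrite ltr_pwDl// invr_gt0.
- have := fge (mxvec B); rewrite /f mxvecK => H.
  have BB : `|B| <= `|mxvec B|.
    by apply: mx_norm_le => // i j; rewrite -mxvecE; exact: mx_norm_entry.
  apply: (@le_trans _ _ (c^-1 * N B)).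
    by rewrite ler_pdivlMl// (le_trans _ H)// ler_wpM2l// ltW.
  by rewrite ler_wpM2r// lerDl.
- by apply: (le_trans (upper B)); rewrite ler_wpM2r// lerDr ltW// invr_gt0.
Qed.

(** * Decay of the fundamental matrix *)

Definition vanishes (R : realType) (n : nat) (X : R -> 'M[R]_n) : Prop :=
  forall e : R, 0 < e -> exists2 T : R, 0 <= T & forall t, T <= t -> `|X t| <= e.

Lemma within_ray_shift (R : realType) (V : normedModType R) (f : R -> V)
    (a b c : R) : {within `[a, +oo[, continuous f} -> a <= b + c ->
  {within `[b, +oo[, continuous (fun s => f (s + c))}.
Proof.
move=> /subspace_continuousP fc abc; apply/subspace_continuousP => t /=.
rewrite in_itv/= andbT => bt.
have := fc (t + c); rewrite /= in_itv/= andbT (le_trans abc) ?lerD2r// => /(_ isT).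
move=> H; apply: (@cvg_comp _ _ _ (fun r => r + c) f _ _ _ _ H).
move=> B [e/= e0 HB]; exists e => //= r re; rewrite in_itv/= andbT => br.
apply: HB => /=; first by rewrite opprD addrACA subrr addr0.
by rewrite in_itv/= andbT (le_trans abc)// lerD2r.
Qed.

(** The shift by at least h is needed because the columns of X itself jump at
    0 and hence do not have a continuous initial function. *)
Lemma shifted_fundamental_solution (R : realType) (n m : nat) (A0 : 'M[R]_n)
    (A : 'I_m -> 'M[R]_n) (tau : 'I_m -> R) (X : R -> 'M[R]_n) (c : R)
    (v : 'cV[R]_n) (x := fun s => X (s + c) *m v) :
    is_fundamental_matrix A0 A tau X -> max_delay tau <= c ->
  {within `[- max_delay tau, 0], continuous x} /\ is_solution A0 A tau x x.
Proof.
move=> [Xc Xd _ _] hc.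
have xc : {within `[- max_delay tau, +oo[, continuous x}.
  have /subspace_continuousP H : {within `[- max_delay tau, +oo[,
      continuous (fun s => X (s + c))}.
    by apply: within_ray_shift Xc _; rewrite addrC subr_ge0.
  by apply/subspace_continuousP => t t0; apply: cvg_mulmxr; exact: H.
split; first by apply: continuous_subspaceW xc => s /=; rewrite !in_itv/= => /andP[->].
split=> [//||t t0].
  apply: continuous_subspaceW xc => s /=; rewrite !in_itv/= !andbT.
  by apply: le_trans; rewrite oppr_le0 max_delay_ge0.
rewrite /x delay_rhs_mulmxr delay_rhs_shift.
apply: right_derivative_mulmxr; apply: right_derivative_shift; apply: Xd.
by rewrite addr_ge0// (le_trans _ hc)// max_delay_ge0.
Qed.

Lemma mx_norm_col (R : realType) (n p : nat) (B : 'M[R]_(n, p)) (j : 'I_p) :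
  `|B *m (delta_mx j 0 : 'cV_p)| <= `|B|.
Proof.
by rewrite -colE; apply: mx_norm_le => // i k; rewrite mxE mx_norm_entry.
Qed.

Lemma mx_norm_le_col (R : realType) (n p : nat) (B : 'M[R]_(n, p)) (c : R) :
  0 <= c -> (forall j, `|B *m (delta_mx j 0 : 'cV_p)| <= c) -> `|B| <= c.
Proof.
move=> c0 Bc; apply: mx_norm_le => // i j; apply: le_trans (Bc j).
by rewrite -colE; have := mx_norm_entry (col j B) i 0; rewrite mxE.
Qed.

Lemma attractive_vanishes (R : realType) (n m : nat) (A0 : 'M[R]_n)
    (A : 'I_m -> 'M[R]_n) (tau : 'I_m -> R) (X : R -> 'M[R]_n) :
    is_fundamental_matrix A0 A tau X -> asymptotically_stable A0 A tau ->
  vanishes X.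
Proof.
move=> HX [_ attr] e e0; set h := max_delay tau.
have H : \forall t \near +oo, forall j : 'I_n,
    `|X (t + h) *m (delta_mx j 0 : 'cV_n)| <= e.
  apply: filter_forall => j.
  have [xc xs] := shifted_fundamental_solution (delta_mx j 0) HX (lexx h).
  have /cvgrPdist_le/(_ e e0) := attr _ _ xc xs.
  by apply: filterS => t; rewrite sub0r normrN.
have [M [_ HM]] := H.
exists (Num.max 0 (M + 1 + h)); first by rewrite le_max lexx.
move=> t; rewrite ge_max => /andP[t0 Mt].
apply: mx_norm_le_col => [|j]; first exact: ltW.
rewrite -(subrK h t); apply: HM.
by rewrite ltrBrDr (lt_le_trans _ Mt)// ltrD2r ltrDl.
Qed.

Lemma segment_bounded (R : realType) (V : normedModType R) (f : R -> V) (a b : R) :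
  {within `[a, b], continuous f} ->
  exists2 B : R, 0 < B & forall t, a <= t <= b -> `|f t| <= B.
Proof.
move=> fc; have [ab|ba] := leP a b; last first.
  by exists 1 => // t /andP[/le_trans] /[apply]; rewrite leNgt ba.
have nc : {within `[a, b], continuous (fun t => `|f t|)}.
  apply/subspace_continuousP => t tab; apply: cvg_norm.
  by move/subspace_continuousP: fc; exact.
have [c cab H] := EVT_max ab nc.
exists (`|f c| + 1); first by rewrite ltr_wpDl.
by move=> t tab; rewrite (le_trans (H t _)) ?lerDl// in_itv.
Qed.

Lemma vanishes_bounded (R : realType) (n m : nat) (A0 : 'M[R]_n)
    (A : 'I_m -> 'M[R]_n) (tau : 'I_m -> R) (X : R -> 'M[R]_n) :
    is_fundamental_matrix A0 A tau X -> vanishes X ->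
  exists2 B : R, 0 < B & forall t, `|X t| <= B.
Proof.
move=> [Xc _ Xn _] /(_ 1 ltr01)[T T0 HT].
have [B B0 HB] : exists2 B : R, 0 < B & forall t, 0 <= t <= T -> `|X t| <= B.
  apply: segment_bounded; apply: continuous_subspaceW Xc => s /=.
  by rewrite !in_itv/= => /andP[->].
exists (B + 1) => [|t]; first by rewrite addr_gt0.
have [t0|t0] := leP 0 t; last by rewrite Xn// normr0 addr_ge0// ltW.
have [tT|Tt] := leP t T.
  by rewrite (le_trans (HB t _)) ?t0 ?tT// lerDl.
by rewrite (le_trans (HT t (ltW Tt)))// lerDr ltW.
Qed.

(** Apply the fundamental estimate to the solution X(. + s) v with s = t - T0 - h:
    its initial function is bounded by the values of X on [s - h, s], where the
    induction hypothesis holds, and at time T0 + h the factor C sup |X| is at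
    most 1/2. *)
Lemma vanishes_geometric (R : realType) (n m : nat) (A0 : 'M[R]_n)
    (A : 'I_m -> 'M[R]_n) (tau : 'I_m -> R) (X : R -> 'M[R]_n) :
    (forall j, 0 < tau j) -> is_fundamental_matrix A0 A tau X -> vanishes X ->
  exists B T : R, [/\ 0 < B, 0 < T &
    forall (k : nat) t, k%:R * T <= t -> `|X t| <= B * 2^-1 ^+ k].
Proof.
move=> tau0 HX Xv; have [C C0 HC] := solution_norm_le tau0 HX.
have [B B0 HB] := vanishes_bounded HX Xv.
have [T0 T0_ge0 HT0] : exists2 T : R, 0 <= T & forall t, T <= t ->
    `|X t| <= (2 * C)^-1.
  by apply: Xv; rewrite invr_gt0 mulr_gt0.
set h := max_delay tau in HC; have h0 : 0 <= h := max_delay_ge0 tau.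
exists B, (T0 + h + h + 1); split=> //.
  by rewrite ltr_wpDl// !addr_ge0.
elim=> [|k IH] t kt; first by rewrite expr0 mulr1.
have kT : k%:R * (T0 + h + h + 1) + (T0 + h + h + 1) <= t.
  by move: kt; rewrite -natr1 mulrDl mul1r.
have kT0 : 0 <= k%:R * (T0 + h + h + 1) by rewrite mulr_ge0// !addr_ge0.
apply: mx_norm_le_col => [|j]; first by rewrite mulr_ge0 ?exprn_ge0 ?ltW// invr_ge0.
pose s := t - (T0 + h).
have hs : h <= s by rewrite /s; lra.
have [xc xs] := shifted_fundamental_solution (delta_mx j 0) HX hs.
have := HC _ _ (B * 2^-1 ^+ k) (2 * C)^-1 (T0 + h) xc _ xs.
rewrite (_ : T0 + h + s = t) /s; last by rewrite addrC subrK.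
have -> : C * (2 * C)^-1 * (B * 2^-1 ^+ k) = B * 2^-1 ^+ k.+1.
  by rewrite exprS; field; rewrite gt_eqF.
apply.
- move=> r /andP[hr r0]; apply: (le_trans (mx_norm_col _ _)).
  by apply: IH; rewrite /s; lra.
- by rewrite addr_ge0.
- by move=> r /andP[hr _]; apply: HT0; lra.
Qed.

Lemma norm_primitive (R : realType) (n m : nat) (A0 : 'M[R]_n)
    (A : 'I_m -> 'M[R]_n) (tau : 'I_m -> R) (N : 'M[R]_n -> R)
    (X : R -> 'M[R]_n)
    (J := fun t => \int[@lebesgue_measure R]_(s in `[0, t]) N (X s)) :
    is_matrix_norm N -> is_fundamental_matrix A0 A tau X ->
  [/\ forall t, t <= 0 -> J t = 0,
      forall t, J s @[s --> t^'-] --> J t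
    & forall t, 0 <= t -> right_derivative J t (N (X t))].
Proof.
move=> HN [Xc _ _ _]; apply: integral_right_primitive => t.
have [C [_ _ NC]] := matrix_norm_equiv HN.
have [N_eq0 NZ ND] := HN.
have NB B B' : N B - N B' <= C * `|B - B'|.
  by rewrite lerBlDr (le_trans _ (lerD (NC _) (lexx _)))// -{1}(subrK B' B).
have Nc : continuous N.
  apply: (@lipschitz_bound_continuous _ _ _ _ C) => B B'.
  by rewrite ler_norml lerNl opprB NB distrC NB.
apply: (@cvg_comp _ _ _ X N); first exact: Xc.
exact: Nc.
Qed.

(** On the k-th interval of length T the integrand is at most C B 2^-k, so the
    integrals are bounded by a geometric sum; they increase with the upper
    limit. *)
Lemma vanishes_integral (R : realType) (n m : nat) (A0 : 'M[R]_n)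
    (A : 'I_m -> 'M[R]_n) (tau : 'I_m -> R) (N : 'M[R]_n -> R)
    (X : R -> 'M[R]_n) :
    (forall j, 0 < tau j) -> is_matrix_norm N ->
    is_fundamental_matrix A0 A tau X -> vanishes X ->
  improper_integral_exists (fun s => N (X s)).
Proof.
move=> tau0 HN HX Xv; rewrite /improper_integral_exists.
set J := (J in J @ _).
have [J0 Jl Jd] : [/\ forall t, t <= 0 -> J t = 0,
      forall t, J s @[s --> t^'-] --> J t
    & forall t, 0 <= t -> right_derivative J t (N (X t))].
  exact: norm_primitive HN HX.
have [C [C0 NC CN]] := matrix_norm_equiv HN.
have N0 B : 0 <= N B by rewrite -(pmulr_rge0 _ C0) (le_trans _ (NC B)).
have [B [T [B0 T0 XB]]] := vanishes_geometric tau0 HX Xv.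
have Jmono s t : s <= t -> J s <= J t.
  move=> st; have [s0|s0] := leP 0 s; last first.
    by rewrite (J0 s (ltW s0)); apply: Rintegral_ge0 => r _; exact: N0.
  suff : `|(0 : R) - 0| <= J t - J s by rewrite subrr normr0 subr_ge0.
  apply: (@mean_value_right _ _ (fun=> 0) (fun=> 0) J (N \o X) _ _ st).
  - by move=> r _; exact: cvg_cst.
  - by move=> r _; exact: Jl.
  - by move=> r _; exact: right_derivative_cst.
  - by move=> r /andP[sr _]; apply: Jd; exact: le_trans sr.
  - by move=> r _; rewrite normr0; exact: N0.
have Jk k : J (k%:R * T) <= 2 * T * C * B * (1 - 2^-1 ^+ k).
  elim: k => [|k IH]; first by rewrite mul0r J0// expr0 subrr mulr0.
  have kT : k%:R * T <= k.+1%:R * T by rewrite ler_wpM2r ?ler_nat// ltW.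
  have H : `|J (k.+1%:R * T) - J (k%:R * T)| <=
      k.+1%:R * T * (C * (B * 2^-1 ^+ k)) - k%:R * T * (C * (B * 2^-1 ^+ k)).
    apply: (@mean_value_right _ _ J (N \o X)
      (fun t => t * (C * (B * 2^-1 ^+ k))) (fun=> C * (B * 2^-1 ^+ k)) _ _ kT).
    - by move=> r _; exact: Jl.
    - move=> r _; apply: cvg_at_left_filter.
      by apply: cvgM; [exact: cvg_id|exact: cvg_cst].
    - by move=> r /andP[kr _]; apply: Jd; rewrite (le_trans _ kr)// mulr_ge0// ltW.
    - by move=> r _; exact: right_derivative_linear.
    - move=> r /andP[kr _]; rewrite /= ger0_norm// (le_trans (CN _))//.
      by rewrite ler_pM2l//; exact: XB.
  have := le_trans (ler_norm _) H; rewrite -natr1 exprS; nra.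
apply/cvg_ex; exists (sup (range J)); apply: nondecreasing_cvgr => //.
exists (2 * T * C * B) => _ [t _ <-].
pose k := Num.bound `|t / T|.
have tk : t <= k%:R * T.
  rewrite -ler_pdivrMr// (le_trans (ler_norm _))// ltW//.
  by apply: archi_boundP.
apply: (le_trans (Jmono _ _ tk)); apply: (le_trans (Jk k)).
rewrite ler_piMr ?mulr_ge0 ?ltW// gerDl oppr_le0 exprn_ge0// invr_ge0//.
Qed.

(** The increments of P are controlled by those of the integral J of N(X), so P
    satisfies the Cauchy criterion and has a limit Q; then X tends to
    L = I + A0 Q + sum_j A_j Q.  Over an interval [T, T + 1] far out, P moves by
    nearly L on the one hand and by nearly 0 on the other. *)
Lemma integral_vanishes (R : realType) (n m : nat) (A0 : 'M[R]_n)
    (A : 'I_m -> 'M[R]_n) (tau : 'I_m -> R) (N : 'M[R]_n -> R)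
    (X : R -> 'M[R]_n) :
    (forall j, 0 < tau j) -> is_matrix_norm N ->
    is_fundamental_matrix A0 A tau X ->
    improper_integral_exists (fun s => N (X s)) -> vanishes X.
Proof.
move=> tau0 HN HX /cvg_ex[/= l]; set J := (J in J @ _) => Jcv.
have [J0 Jl Jd] : [/\ forall t, t <= 0 -> J t = 0,
      forall t, J s @[s --> t^'-] --> J t
    & forall t, 0 <= t -> right_derivative J t (N (X t))].
  exact: norm_primitive HN HX.
have [C [C0 NC CN]] := matrix_norm_equiv HN.
have [P [P0 Pl Pd PX]] := fundamental_primitive tau0 HX.
have PJ s t : 0 <= s -> s <= t -> `|P t - P s| <= C * J t - C * J s.
  move=> s0 st; apply: (@mean_value_right _ _ P X (fun r => C * J r)
    (fun r => C * N (X r)) _ _ st).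
  - by move=> r _; exact: Pl.
  - by move=> r _; apply: cvgM; [exact: cvg_cst|exact: Jl].
  - by move=> r _; exact: Pd.
  - move=> r /andP[sr _]; rewrite /right_derivative.
    under eq_fun do rewrite -mulrBr -[_ *: (_ * _)]mulrCA.
    apply: cvgM; first exact: cvg_cst.
    by apply: Jd; exact: le_trans sr.
  - by move=> r _; exact: NC.
have Pclose e : 0 < e -> exists2 T : R, 0 <= T &
    forall s t, T <= s -> s <= t -> `|P t - P s| <= e.
  move=> e0; have /cvgrPdist_le/(_ (e / (2 * C))) := Jcv.
  rewrite divr_gt0 ?mulr_gt0// => /(_ isT)[M [_ HM]].
  exists (Num.max 0 (M + 1)); first by rewrite le_max lexx.
  move=> s t; rewrite ge_max => /andP[s0 Ms] st; apply: (le_trans (PJ _ _ s0 st)).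
  have Hs : `|l - J s| <= e / (2 * C).
    by apply: HM; rewrite (lt_le_trans _ Ms)// ltrDl.
  have Ht : `|l - J t| <= e / (2 * C).
    by apply: HM; rewrite (lt_le_trans _ (le_trans Ms st))// ltrDl.
  rewrite -mulrBr (_ : e = C * (e / (2 * C) + e / (2 * C))); last first.
    by field; rewrite gt_eqF.
  rewrite ler_pM2l//; move: Hs Ht; rewrite !ler_norml; lra.
have [Q HQ] : exists Q : 'M[R]_n, forall e, 0 < e -> exists2 T : R, 0 <= T &
    forall t, T <= t -> `|P t - Q| <= e.
  have : cvg (P @ +oo).
    apply: cauchy_cvg; apply: cauchy_exP => e e0.
    have [T T0 HT] := Pclose _ (divr_gt0 e0 (ltr0n R 2)).
    exists (P T); exists T; split; first exact: num_real.
    move=> t Tt; rewrite -ball_normE/= distrC.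
    apply: le_lt_trans (HT T t (lexx T) (ltW Tt)) _.
    by rewrite ltr_pdivrMr// ltr_pMr// ltr1n.
  move=> /cvg_ex[/= Q PQ]; exists Q => e e0.
  have /cvgrPdist_le/(_ e e0)[M [_ HM]] := PQ.
  exists (Num.max 0 (M + 1)); first by rewrite le_max lexx.
  move=> t; rewrite ge_max => /andP[_ Mt]; rewrite distrC; apply: HM.
  by rewrite (lt_le_trans _ Mt)// ltrDl.
set K := delay_norm A0 A; have K0 : 0 <= K := delay_norm_ge0 A0 A.
pose L := 1%:M + delay_rhs A0 A tau (fun=> Q) 0.
have XL e : 0 < e -> exists2 T : R, 0 <= T & forall t, T <= t -> `|X t - L| <= e.
  move=> e0; have K1 : 0 < K + 1 by rewrite ltr_wpDl.
  have [T T0 HT] := HQ _ (divr_gt0 e0 K1).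
  exists (T + max_delay tau); first by rewrite addr_ge0// max_delay_ge0.
  move=> t Tt; have Tt' : T <= t by rewrite (le_trans _ Tt)// lerDl max_delay_ge0.
  rewrite PX (le_trans T0 Tt') /L opprD addrACA subrr add0r.
  rewrite -[delay_rhs A0 A tau (fun=> Q) 0]/(delay_rhs A0 A tau (fun=> Q) t).
  rewrite -delay_rhsB; apply: (@le_trans _ _ (K * (e / (K + 1)))).
    apply: delay_rhs_norm_le => [|j]; apply: HT => //.
    by rewrite lerBrDr (le_trans _ Tt)// lerD2l max_delay_ge.
  by rewrite mulrA ler_pdivrMr// mulrC ler_pM2l// lerDl.
have L0 : L = 0.
  apply/eqP; rewrite -normr_le0; apply/ler_addgt0Pr => e e0; rewrite add0r.
  have e2 : 0 < e / 2 by rewrite divr_gt0.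
  have [T1 T10 HT1] := XL _ e2; have [T2 T20 HT2] := Pclose _ e2.
  pose T := Num.max T1 T2.
  have T_ge0 : 0 <= T by rewrite le_max T10.
  have TS : T <= T + 1 by rewrite lerDl.
  have H : `|(P (T + 1) - (T + 1) *: L) - (P T - T *: L)| <=
      (T + 1) *: (e / 2) - T *: (e / 2).
    apply: (@mean_value_right _ _ (fun s => P s - s *: L) (fun s => X s - L)
      (fun s => s *: (e / 2)) (fun=> e / 2) _ _ TS).
    - move=> r _; apply: cvgB; first exact: Pl.
      by apply: cvg_at_left_filter; apply: cvgZr_tmp; exact: cvg_id.
    - move=> r _; apply: cvg_at_left_filter.
      by apply: cvgZr_tmp; exact: cvg_id.
    - move=> r _; apply: right_derivativeB; first exact: Pd.
      exact: right_derivative_linear.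
    - by move=> r _; exact: right_derivative_linear.
    - move=> r /andP[Tr _]; apply: HT1; apply: le_trans Tr.
      by rewrite le_max lexx.
  have H2 : `|P (T + 1) - P T| <= e / 2.
    by apply: HT2 => //; rewrite le_max lexx orbT.
  have T1T : T + 1 - T = 1 by rewrite addrC addKr.
  move: H; rewrite -scalerBl T1T scale1r => H.
  have -> : L = (P (T + 1) - P T) -
      (P (T + 1) - (T + 1) *: L - (P T - T *: L)).
    move: (L) (P (T + 1)) (P T) => L' a b.
    by apply/matrixP => i j; rewrite !mxE; ring.
  by rewrite [e]splitr (le_trans (ler_normB _ _))// lerD.
by move=> e /XL; rewrite L0 => -[T T0 HT]; exists T => // t /HT; rewrite subr0.
Qed.

Lemma vanishes_stable (R : realType) (n m : nat) (A0 : 'M[R]_n)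
    (A : 'I_m -> 'M[R]_n) (tau : 'I_m -> R) (X : R -> 'M[R]_n) :
    (forall j, 0 < tau j) -> is_fundamental_matrix A0 A tau X -> vanishes X ->
  asymptotically_stable A0 A tau.
Proof.
move=> tau0 HX Xv; have [C C0 HC] := solution_norm_le tau0 HX.
have [B B0 HB] := vanishes_bounded HX Xv.
split=> [e e0|phi x phic xs].
  have CB : 0 < C * B + 1 by rewrite addr_gt0// mulr_gt0.
  exists (e / (C * B + 1)); first exact: divr_gt0.
  move=> phi x phic phid xs t t0.
  apply: (@le_lt_trans _ _ (C * B * (e / (C * B + 1)))).
    by apply: (HC phi x) => // s hs; apply: ltW; exact: phid.
  by rewrite mulrA ltr_pdivrMr// mulrC ltr_pM2l// ltrDl.
have [d d0 phid] := segment_bounded phic.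
apply/cvgrPdist_le => e e0.
have Cd : 0 < C * d by rewrite mulr_gt0.
have [T T0 HT] := Xv _ (divr_gt0 e0 Cd).
exists (T + max_delay tau); split; first exact: num_real.
move=> t Tt; rewrite sub0r normrN.
have -> : e = C * (e / (C * d)) * d by field; rewrite !gt_eqF.
apply: (HC phi x) => //.
  by rewrite (le_trans _ (ltW Tt))// addr_ge0// max_delay_ge0.
move=> s /andP[hs _]; apply: HT; apply: le_trans hs.
by rewrite lerBrDr ltW.
Qed.

(** * The stability criterion *)

Unset Implicit Arguments.

Theorem theorem3p2 (R : realType) (n m : nat) (hn : (1 <= n)%N) (hm : (1 <= m)%N)
    (A0 : 'M[R]_n) (A : 'I_m -> 'M[R]_n) (tau : 'I_m -> R)
    (htau : forall j, 0 < tau j)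
    (N : 'M[R]_n -> R) (hN : is_matrix_norm N)
    (X : R -> 'M[R]_n) (hX : is_fundamental_matrix A0 A tau X) :
  asymptotically_stable A0 A tau <->
  improper_integral_exists (fun s => N (X s)).
Proof.
split=> [stable|int].
  by apply: (vanishes_integral htau hN hX); exact: attractive_vanishes hX stable.
by apply: (vanishes_stable htau hX); exact: integral_vanishes htau hN hX int.
Qed.
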